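(* Let $n\ge 2$ and let $B_1,\dots,B_n$ be left braces, with lambda maps $\lambda^{(1)},\dots,\lambda^{(n)}$ respectively. Let $B=(\dots(B_1\bowtie B_2)\bowtie\dots)\bowtie B_n$ be an iterated matched product of left braces. Then $B$ is an iterated matched product of left ideals if and only if there exist group homomorphisms $$\alpha^{(j,i)}\colon (B_j,\cdot)\longrightarrow \operatorname{Aut}(B_i,+),\quad b\mapsto \alpha^{(j,i)}_b \qquad (i,j\in\{1,\dots,n\},\ i\ne j)$$ such that $$\lambda^{(i)}_a\circ\alpha^{(j,i)}_{(\alpha^{(i,j)}_{a})^{-1}(b)}=\alpha^{(j,i)}_b\circ\lambda^{(i)}_{(\alpha^{(j,i)}_b)^{-1}(a)} \qquad\text{and}\qquad \alpha^{(k,i)}_c\circ\alpha^{(j,i)}_{(\alpha^{(k,j)}_{c})^{-1}(b)}=\alpha^{(j,i)}_b\circ\alpha^{(k,i)}_{(\alpha^{(j,k)}_b)^{-1}(c)}$$ for all $a\in B_i$, $b\in B_j$, $c\in B_k$ and all $i,j,k\in\{1,\dots,n\}$ with $j\neq i$, $k\ne i$ and $k\neq j$ (the first identity involving only $i\ne j$), and furthermore, for every $1\le j<n$, $(\dots(B_1\bowtie B_2)\bowtie\dots)\bowtie B_{j+1}$ is the matched product corresponding to the matched pair of left braces $$\bigl((\dots(B_1\bowtie B_2)\bowtie\dots)\bowtie B_j,\ B_{j+1},\ \alpha^{(j+1,(1,\dots,j))},\ \alpha^{((1,\dots,j),j+1)}\bigr),$$ where, for $a_k\in B_k$, $$\alpha^{((1,\dots,j),j+1)}_{(a_1,\dots,a_{j})}=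 \alpha^{(1,j+1)}_{a_{1}}\,\alpha^{(2,j+1)}_{(\alpha^{(1,2)}_{a_1})^{-1}(a_{2})}\cdots\alpha^{(j,j+1)}_{(\alpha^{((1,\dots,j-1),j)}_{(a_1,\dots,a_{j-1})})^{-1}(a_{j})},$$ $$\alpha^{(j+1,(1,\dots,j))}_{a_{j+1}}(a_1,\dots,a_{j})=\bigl(\alpha^{(j+1,1)}_{a_{j+1}}(a_1),\dots,\alpha^{(j+1,j)}_{a_{j+1}}(a_{j})\bigr).$$ Here the first formula is recursive in $j$: the $k$-th factor is $\alpha^{(k,j+1)}$ evaluated at $(\alpha^{((1,\dots,k-1),k)}_{(a_1,\dots,a_{k-1})})^{-1}(a_k)$ for $2\le k\le j$, and $\alpha^{((1),2)}=\alpha^{(1,2)}$.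
   Context: A left brace is a set $B$ with operations $+,\cdot$ such that $(B,+)$ is an abelian group, $(B,\cdot)$ is a group and $a\cdot(b+c)+a=a\cdot b+a\cdot c$ for all $a,b,c\in B$. Its lambda map is the group homomorphism $\lambda\colon(B,\cdot)\to\operatorname{Aut}(B,+)$, $\lambda_a(b)=ab-a$. A left ideal of $B$ is a subgroup $S$ of $(B,\cdot)$ with $\lambda_b(a)\in S$ for all $a\in S$, $b\in B$. Let $G,H$ be left braces with lambda maps $\lambda^{(1)},\lambda^{(2)}$, and let $\alpha\colon(H,\cdot)\to\operatorname{Aut}(G,+)$, $b\mapsto\alpha_b$, and $\beta\colon(G,\cdot)\to\operatorname{Aut}(H,+)$, $a\mapsto\beta_a$, be group homomorphisms. The tuple $(G,H,\alpha,\beta)$ is a matched pair of left braces if for all $a\in G$, $b\in H$: $\lambda_a^{(1)}\circ\alpha_b=\alpha_{\beta_a(b)}\circ\lambda^{(1)}_{\alpha^{-1}_{\beta_a(b)}(a)}$ and $\lambda_b^{(2)}\circ\beta_a=\beta_{\alpha_b(a)}\circ\lambda^{(2)}_{\beta^{-1}_{\alpha_b(a)}(b)}$. In that case the matched product $G\bowtie H$ is the left brace on $G\times H$ with componentwise addition and lambda map $\lambda_{(a,b)}(a',b')=\bigl(\alpha_b\lambda^{(1)}_{\alpha_b^{-1}(a)}(a'),\ \beta_a\lambda^{(2)}_{\beta_a^{-1}(b)}(b')\bigr)$ (and multiplication $x\cdot y=x+\lambda_x(y)$). An iterated matched product $(\dots(B_1\bowtie B_2)\bowtie\dots)\bowtie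 B_n$ is a left brace obtained by successively forming matched products, starting with $B_1\bowtie B_2$ and, for each $j$, forming the matched product of the already constructed left brace $(\dots(B_1\bowtie B_2)\bowtie\dots)\bowtie B_j$ with $B_{j+1}$ with respect to some matched pair; its underlying additive group is $B_1\times\dots\times B_n$. It is called an iterated matched product of left ideals if, for each $i$, the subset $\{0\}\times\dots\times\{0\}\times B_i\times\{0\}\times\dots\times\{0\}$ is a left ideal of it. *)

(* Defs.v *)
From HB Require Import structures.
From mathcomp Require Import all_boot all_order all_algebra.
From mathcomp Require Import boolp.

Set Implicit Arguments.
Unset Strict Implicit.
Unset Printing Implicit Defensive.

Import GRing.Theory.
Local Open Scope ring_scope.
Local Open Scope group_scope.

(** The group Aut(A,+), with composition as product: (f * g) x = f (g x). *)

Record zmodAut (A : zmodType) := ZmodAut {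
  aut_fun :> A -> A;
  aut_inv : A -> A;
  aut_funD : {morph aut_fun : x y / (x + y)%R};
  aut_funK : cancel aut_fun aut_inv;
  aut_invK : cancel aut_inv aut_fun }.

Section ZmodAut.
Variable A : zmodType.
Implicit Types f g h : zmodAut A.

Lemma zmodAutP f g : f =1 g -> f = g.
Proof.
case: f g => [f f' fD fK f'K] [g g' gD gK g'K] /= /funext efg.
rewrite {}efg in fD fK f'K *.
have ef' : f' = g' by apply/funext => x; rewrite -[x in LHS]g'K fK.
rewrite {}ef' in fK f'K *.
by congr ZmodAut; apply: Prop_irrelevance.
Qed.

Definition aut_one : zmodAut A :=
  @ZmodAut A id id (fun x y => erefl) (fun x => erefl) (fun x => erefl).

Definition aut_mul f g : zmodAut A.
Proof.
apply: (@ZmodAut A (f \o g) (aut_inv g \o aut_inv f)).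
- by move=> x y /=; rewrite !aut_funD.
- by apply: can_comp; apply: aut_funK.
- by apply: can_comp; apply: aut_invK.
Defined.

Definition aut_inverse f : zmodAut A.
Proof.
apply: (@ZmodAut A (aut_inv f) f).
- by move=> x y; apply: (can_inj (aut_funK f)); rewrite aut_funD !aut_invK.
- exact: aut_invK.
- exact: aut_funK.
Defined.

HB.instance Definition _ := gen_eqMixin (zmodAut A).
HB.instance Definition _ := gen_choiceMixin (zmodAut A).

Fact aut_mulA : associative aut_mul.
Proof. by move=> f g h; apply: zmodAutP. Qed.
Fact aut_mul1 : left_id aut_one aut_mul.
Proof. by move=> f; apply: zmodAutP. Qed.
Fact aut_mulr1 : right_id aut_one aut_mul.
Proof. by move=> f; apply: zmodAutP. Qed.
Fact aut_mulV : left_inverse aut_one aut_inverse aut_mul.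
Proof. by move=> f; apply: zmodAutP => x; apply: aut_funK. Qed.
Fact aut_mulrV : right_inverse aut_one aut_inverse aut_mul.
Proof. by move=> f; apply: zmodAutP => x; apply: aut_invK. Qed.

HB.instance Definition _ := isGroup.Build (zmodAut A)
  aut_mulA aut_mul1 aut_mulr1 aut_mulV aut_mulrV.

Fact aut_fun_additive f : zmod_morphism (f : A -> A).
Proof.
move=> x y; apply/eqP; rewrite eq_sym subr_eq -aut_funD.
by rewrite -addrA addNr addr0.
Qed.

HB.instance Definition _ f :=
  GRing.isZmodMorphism.Build A A (f : A -> A) (aut_fun_additive f).

Lemma autM f g x : (f * g) x = f (g x). Proof. by []. Qed.
Lemma aut1 x : (1 : zmodAut A) x = x. Proof. by []. Qed.
Lemma autKV f x : f (f^-1 x) = x. Proof. exact: aut_invK. Qed.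
Lemma autVK f x : f^-1 (f x) = x. Proof. exact: aut_funK. Qed.

End ZmodAut.

Definition aut_prod (A C : zmodType) (f : zmodAut A) (g : zmodAut C) :
  zmodAut (A * C)%type.
Proof.
apply: (@ZmodAut _ (fun x => (f x.1, g x.2)) (fun x => (f^-1 x.1, g^-1 x.2))).
- by move=> x y; congr pair; apply: raddfD.
- by case=> x y; congr pair; apply: autVK.
- by case=> x y; congr pair; apply: autKV.
Defined.

(** In the ring_scope arguments of [+] and [-], the multiplication of a left
    brace has to be marked by %g: a bare [*] there is the product of a ring. *)

HB.mixin Record isLeftBrace B of GRing.Zmodule B & Group B := {
  brace_mulDr : forall a b c : B, (a * (b + c))%g + a = (a * b)%g + (a * c)%g
}.

#[short(type="leftBraceType")]
HB.structure Definition LeftBrace :=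
  {B of isLeftBrace B & GRing.Zmodule B & Group B}.

Section Lambda.
Variable B : leftBraceType.
Implicit Types a b c : B.

Lemma brace_one : 1 = 0 :> B.
Proof.
by have := brace_mulDr (1 : B) 0 0; rewrite !mul1g !addr0 add0r.
Qed.

Lemma brace_mulBr a b c : a * (b - c) = (a * b)%g + a - (a * c)%g.
Proof. by apply/eqP; rewrite eq_sym subr_eq -brace_mulDr subrK. Qed.

Definition lambda_fun a b : B := (a * b)%g - a.

Fact lambda_funD a : {morph lambda_fun a : x y / x + y}.
Proof.
move=> x y; apply: (addIr a); apply: (addIr a).
rewrite /lambda_fun subrK brace_mulDr -(addrA (_ - a)) subrK addrAC.
by rewrite subrK.
Qed.

Fact lambda_funM a b c : lambda_fun (a * b) c = lambda_fun a (lambda_fun b c).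
Proof. by rewrite /lambda_fun brace_mulBr mulgA addrAC addrK. Qed.

Fact lambda_fun1 c : lambda_fun 1 c = c.
Proof. by rewrite /lambda_fun mul1g brace_one subr0. Qed.

Fact lambda_funK a : cancel (lambda_fun a) (lambda_fun a^-1).
Proof. by move=> x; rewrite -lambda_funM mulVg lambda_fun1. Qed.

Fact lambda_funVK a : cancel (lambda_fun a^-1) (lambda_fun a).
Proof. by move=> x; rewrite -lambda_funM mulgV lambda_fun1. Qed.

Definition lambda a : zmodAut B :=
  ZmodAut (lambda_funD a) (lambda_funK a) (lambda_funVK a).

Lemma lambdaE a b : lambda a b = (a * b)%g - a. Proof. by []. Qed.

Fact lambda_morph : {morph lambda : a b / a * b}.
Proof. by move=> a b; apply: zmodAutP => c; apply: lambda_funM. Qed.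

HB.instance Definition _ := isMultiplicative.Build B (zmodAut B) lambda lambda_morph.

Lemma brace_mulE a b : a * b = a + lambda a b.
Proof. by rewrite lambdaE addrC subrK. Qed.

Definition left_ideal (S : {pred B}) : Prop :=
  group_closed S /\ forall a b : B, a \in S -> lambda b a \in S.

End Lambda.

(** Matched pairs and matched products. *)

Record matched_pair (G H : leftBraceType)
    (alpha : H -> zmodAut G) (beta : G -> zmodAut H) : Prop := MatchedPair {
  matched_morphl : {morph alpha : b c / b * c};
  matched_morphr : {morph beta : a c / a * c};
  matched_l : forall a b,
    lambda a * alpha b =
      alpha (beta a b) * lambda ((alpha (beta a b))^-1 a);
  matched_r : forall a b,
    lambda b * beta a =
      beta (alpha b a) * lambda ((beta (alpha b a))^-1 b) }.

Lemma matched_pairC (G H : leftBraceType) (alpha : H -> zmodAut G)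
    (beta : G -> zmodAut H) :
  matched_pair alpha beta -> matched_pair beta alpha.
Proof. by case=> *; split. Qed.

Definition matched_lambda1 (G H : leftBraceType) (alpha : H -> zmodAut G)
    (a : G) (b : H) : zmodAut G :=
  alpha b * lambda ((alpha b)^-1 a).

Definition matched_lambda (G H : leftBraceType) (alpha : H -> zmodAut G)
    (beta : G -> zmodAut H) (x : G * H) : zmodAut (G * H)%type :=
  aut_prod (matched_lambda1 alpha x.1 x.2) (matched_lambda1 beta x.2 x.1).

Definition matched_mul (G H : leftBraceType) (alpha : H -> zmodAut G)
    (beta : G -> zmodAut H) (x y : G * H) : (G * H)%type :=
  x + matched_lambda alpha beta x y.

Lemma matched_lambda1E (G H : leftBraceType) (alpha : H -> zmodAut G)
    (beta : G -> zmodAut H) (mp : matched_pair alpha beta) a b :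
  matched_lambda1 alpha a b = lambda a * alpha ((beta a)^-1 b).
Proof. by rewrite (matched_l mp) autKV. Qed.

Lemma matched_lambda1M (G H : leftBraceType) (alpha : H -> zmodAut G)
    (beta : G -> zmodAut H) (mp : matched_pair alpha beta) a b c d :
  let z := matched_mul alpha beta (a, b) (c, d) in
  matched_lambda1 alpha z.1 z.2 =
  matched_lambda1 alpha a b * matched_lambda1 alpha c d.
Proof.
move=> z; pose a0 := (alpha b)^-1 a; pose c0 := (alpha d)^-1 c.
pose d' := beta a0 d; pose a0' := (alpha d')^-1 a0.
have m := matched_morphl mp.
have z2E : z.2 = b * d'.
  by rewrite brace_mulE -autM -(matched_lambda1E (matched_pairC mp)).
have z1E : z.1 = alpha (b * d') (a0' * c0).
  rewrite m autM (brace_mulE a0') (aut_funD (alpha d')) [alpha d' a0']autKV.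
  by rewrite aut_funD [alpha b a0]autKV -(autM (alpha d')) -(matched_l mp) autM autKV.
rewrite /matched_lambda1 z1E z2E autVK m lambda_morph -mulgA.
by rewrite [X in _ * X]mulgA -(matched_l mp) !mulgA.
Qed.

Definition matched_prod (G H : leftBraceType) (alpha : H -> zmodAut G)
    (beta : G -> zmodAut H) of matched_pair alpha beta : Type := (G * H)%type.

Section MatchedProduct.
Variables (G H : leftBraceType).
Variables (alpha : H -> zmodAut G) (beta : G -> zmodAut H).
Hypothesis mp : matched_pair alpha beta.
Local Notation L := (matched_lambda alpha beta).
Local Notation M := (matched_mul alpha beta).

Fact matched_lambdaM x y : L (M x y) = L x * L y.
Proof.
case: x y => a b [c d]; apply: zmodAutP => -[u v]; congr pair.
  exact: (congr1 (fun f : zmodAut G => f u) (matched_lambda1M mp a b c d)).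
exact: (congr1 (fun f : zmodAut H => f v)
  (matched_lambda1M (matched_pairC mp) b a d c)).
Qed.

Fact matched_lambda0 : L 0 = 1.
Proof.
have morph1 (K K' : leftBraceType) (f : K -> zmodAut K') :
    {morph f : b c / b * c} -> f 0 = 1.
  by move=> fM; apply: (mulgI (f 1)); rewrite mulg1 -fM mul1g brace_one.
have lambda10 (K K' : leftBraceType) (f : K -> zmodAut K') :
    {morph f : b c / b * c} -> matched_lambda1 f 0 0 = 1.
  move=> fM; rewrite /matched_lambda1 (morph1 _ _ _ fM) invg1 mul1g aut1.
  exact: (morph1 _ _ _ (@lambda_morph _)).
apply: zmodAutP => -[u v]; congr pair.
  exact: (congr1 (fun f : zmodAut G => f u) (lambda10 _ _ _ (matched_morphl mp))).
exact: (congr1 (fun f : zmodAut H => f v) (lambda10 _ _ _ (matched_morphr mp))).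
Qed.

Definition matched_inv (x : G * H) : (G * H)%type := (L x)^-1 (- x).

Fact matched_mulA : associative M.
Proof.
by move=> x y z; rewrite /matched_mul -/(M x y) matched_lambdaM raddfD addrA.
Qed.

Fact matched_mul1 : left_id 0 M.
Proof. by move=> x; rewrite /matched_mul matched_lambda0 add0r. Qed.

Fact matched_mulr1 : right_id 0 M.
Proof. by move=> x; rewrite /matched_mul raddf0 addr0. Qed.

Fact matched_mulrV : right_inverse 0 matched_inv M.
Proof. by move=> x; rewrite /matched_mul autKV subrr. Qed.

Fact matched_mulV : left_inverse 0 matched_inv M.
Proof.
move=> x; rewrite -[x in M _ x]matched_mulr1 -(matched_mulrV (matched_inv x)).
by rewrite [M x _]matched_mulA matched_mulrV matched_mul1 matched_mulrV.
Qed.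

HB.instance Definition _ := GRing.Zmodule.on (matched_prod mp).
HB.instance Definition _ := isGroup.Build (matched_prod mp)
  matched_mulA matched_mul1 matched_mulr1 matched_mulV matched_mulrV.

Fact matched_mulDr (a b c : matched_prod mp) :
  (a * (b + c))%g + a = (a * b)%g + (a * c)%g.
Proof.
have mulE (x y : matched_prod mp) : x * y = x + L x y by [].
by rewrite !mulE aut_funD addrAC [RHS]addrACA.
Qed.

HB.instance Definition _ := isLeftBrace.Build (matched_prod mp) matched_mulDr.

Lemma matched_prod_lambdaE (a a' : G) (b b' : H) :
  lambda ((a, b) : matched_prod mp) (a', b') =
  (alpha b (lambda ((alpha b)^-1 a) a'), beta a (lambda ((beta a)^-1 b) b')).
Proof. by rewrite lambdaE [_ * _]addrC addrK. Qed.

End MatchedProduct.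

(** [iterated_mp B j P]: the left brace P is built as the iterated matched
    product of the first j members of the family B.  As the family is indexed
    by 'I_n, the factor B_(j+1) is B (Ordinal lt_jn) with lt_jn : j < n. *)

Inductive iterated_mp (n : nat) (B : 'I_n -> leftBraceType) :
    nat -> leftBraceType -> Type :=
| IMPfirst (n_gt0 : (0 < n)%N) : iterated_mp B 1 (B (Ordinal n_gt0))
| IMPnext (j : nat) (P : leftBraceType) (D : iterated_mp B j P)
    (lt_jn : (j < n)%N)
    (alpha : B (Ordinal lt_jn) -> zmodAut P)
    (beta : P -> zmodAut (B (Ordinal lt_jn)))
    (mp : matched_pair alpha beta) :
    iterated_mp B j.+1 (matched_prod mp).

Section Iterated.
Variables (n : nat) (B : 'I_n -> leftBraceType).

(** The subset 0 x ... x 0 x B_i x 0 x ... x 0. *)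
Fixpoint axis (i : 'I_n) j P (D : iterated_mp B j P) : pred P :=
  match D with
  | IMPfirst n_gt0 => fun x => (x == 0) || (Ordinal n_gt0 == i)
  | IMPnext _ _ D' lt_jn _ _ _ => fun x =>
      axis i D' x.1 && ((x.2 == 0) || (Ordinal lt_jn == i))
  end.

Definition of_left_ideals P (D : iterated_mp B n P) : Prop :=
  forall i : 'I_n, left_ideal (axis i D).

(** [alpha j i] stands for alpha^(j,i); only the values for j != i are used. *)
Variable alpha : forall j i : 'I_n, {multiplicative B j -> zmodAut (B i)}.

(** alpha^((1,...,j),i) *)
Fixpoint alpha_from j P (D : iterated_mp B j P) (i : 'I_n) :
    P -> zmodAut (B i) :=
  match D with
  | IMPfirst n_gt0 => fun a => alpha (Ordinal n_gt0) i a
  | IMPnext _ _ D' lt_jn _ _ _ => fun a =>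
      alpha_from D' i a.1 *
      alpha (Ordinal lt_jn) i ((alpha_from D' (Ordinal lt_jn) a.1)^-1 a.2)
  end.

(** alpha^(i,(1,...,j)) *)
Fixpoint alpha_to j P (D : iterated_mp B j P) (i : 'I_n) (b : B i) :
    zmodAut P :=
  match D with
  | IMPfirst n_gt0 => alpha i (Ordinal n_gt0) b
  | IMPnext _ _ D' lt_jn _ _ _ =>
      aut_prod (alpha_to D' b) (alpha i (Ordinal lt_jn) b)
  end.

(** At each stage, the left brace that was constructed is the matched product
    for the pair (alpha_to, alpha_from); as carriers and additions agree by
    construction, this is the equality of the two multiplications. *)
Fixpoint matched_via j P (D : iterated_mp B j P) : Prop :=
  match D with
  | IMPfirst _ => True
  | IMPnext _ P' D' lt_jn _ _ mp =>
      matched_via D' /\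
      exists mp' : matched_pair (@alpha_to _ _ D' (Ordinal lt_jn))
                                (@alpha_from _ _ D' (Ordinal lt_jn)),
      forall x y : P' * B (Ordinal lt_jn),
        (x : matched_prod mp) * (y : matched_prod mp) =
        (x : matched_prod mp') * (y : matched_prod mp')
  end.

End Iterated.

(* Main.v *)
Require Import Defs.
From HB Require Import structures.
From mathcomp Require Import all_boot all_order all_algebra.
From mathcomp Require Import boolp.

Set Implicit Arguments.
Unset Strict Implicit.
Unset Printing Implicit Defensive.

(** Everything comes from one identity in a left brace: the sum [u + v] is the
product [u * (lambda u)^-1 v] ([add_mulE]), and addition is commutative, so
[lambda u * lambda ((lambda u)^-1 v)] and
[lambda v * lambda ((lambda v)^-1 u)] are the same automorphism,
[lambda (u + v)].

Assume that the axes are left ideals of the final brace [Q]. Then [lambda]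
restricts on each of them to an action of [Q] on [B i] ([action]), and
alpha^(j,i) has to be the restriction of this action to the axis of [B j]
([ideal_alpha]). For [j = i] this restriction is the lambda map of [B i],
because every factor embeds as a left brace in its axis ([axis_in_hom]); so
the two families of identities in the theorem are a single statement,
[ideal_alpha_compat], and this is the identity above restricted to the axis of
[B i], for [u] and [v] on two other axes.

It remains to see that the construction is recovered from these actions. Each
intermediate stage embeds in [Q] with the same axes ([stage_embedding]). The
action of a new factor on the earlier stage is determined on each axis, hence
is componentwise ([alpha_to_lambda]). The action of the earlier stage is
computed by writing [(a, b) = (a, 0) + (0, b)] and applying the identity once
more: the recursive formula for alpha^((1,...,j),i) is nothing but the
factorisation of a sum of axis elements as a product ([alpha_from_action]).
Comparing with the lambda map of a matched product identifies the matched pair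
used at every stage ([matched_via_ideals]).

For the converse, the axes are additive subgroups, and in a matched product
built from a componentwise alpha^(j+1,(1,...,j)) the lambda map cannot leave
an axis ([axis_lambda]); in a left brace this makes them left ideals
([left_idealP]). *)

Import GRing.Theory.
Local Open Scope ring_scope.
Local Open Scope group_scope.

(** * Left braces and their lambda maps *)

Lemma morphM_at0 (B : leftBraceType) (K : groupType) (f : B -> K) :
  {morph f : a b / a * b} -> f 0 = 1.
Proof.
by move=> fM; apply: (mulgI (f 1)); rewrite mulg1 -fM mul1g brace_one.
Qed.

Lemma lambda0 (B : leftBraceType) : lambda (0 : B) = 1.
Proof. exact: morphM_at0 (@lambda_morph B). Qed.

Lemma lambdaV (B : leftBraceType) (a : B) : lambda a^-1 = (lambda a)^-1.
Proof.
by apply: (mulgI (lambda a)); rewrite -lambda_morph !mulgV brace_one lambda0.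
Qed.

(** As [a * b = a + lambda a b] and [a^-1 = - lambda a^-1 a], an additive
    subgroup stable under [lambda] is automatically a multiplicative one. *)
Lemma left_idealP (B : leftBraceType) (S : {pred B}) :
  0 \in S -> {in S &, forall x y, x - y \in S} ->
  (forall a b : B, a \in S -> lambda b a \in S) -> left_ideal S.
Proof.
move=> S0 SB Sl; split=> //; split=> [|x y Sx Sy]; first by rewrite brace_one.
have SN z : z \in S -> - z \in S by move=> Sz; rewrite -sub0r SB.
have yV : y^-1 = - lambda y^-1 y by rewrite lambdaE mulVg brace_one sub0r opprK.
by rewrite brace_mulE -[lambda x _]opprK SB // SN // Sl // yV SN // Sl.
Qed.

(** The source of all compatibility conditions: exchanging [u] and [v] gives a
    second factorisation of the same element. *)
Lemma add_mulE (B : leftBraceType) (u v : B) : u + v = u * (lambda u)^-1 v.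
Proof. by rewrite brace_mulE autKV. Qed.

Record brace_hom (B C : leftBraceType) (f : B -> C) : Prop := BraceHom {
  brace_homD : {morph f : x y / x + y};
  brace_homM : {morph f : x y / x * y} }.

Section BraceHom.
Variables (B C : leftBraceType) (f : B -> C).
Hypothesis fH : brace_hom f.

Lemma brace_hom0 : f 0 = 0.
Proof.
rewrite -!brace_one; apply: (mulgI (f 1)).
by rewrite -(brace_homM fH) !mulg1.
Qed.

Lemma brace_homN x : f (- x) = - f x.
Proof. by apply: (addrI (f x)); rewrite -(brace_homD fH) !subrr brace_hom0. Qed.

Lemma brace_hom_lambda x y : f (lambda x y) = lambda (f x) (f y).
Proof. by rewrite !lambdaE (brace_homD fH) brace_homN (brace_homM fH). Qed.

End BraceHom.

Lemma brace_hom_comp (B C K : leftBraceType) (g : C -> K) (f : B -> C) :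
  brace_hom g -> brace_hom f -> brace_hom (g \o f).
Proof.
by move=> gH fH; split=> x y /=;
  rewrite ?(brace_homD fH) ?(brace_homD gH) ?(brace_homM fH) ?(brace_homM gH).
Qed.

(** * The two factors of a matched product *)

Section Factors.
Variables (G H : leftBraceType).
Variables (alpha : H -> zmodAut G) (beta : G -> zmodAut H).
Hypothesis mp : matched_pair alpha beta.

Let alpha0 : alpha 0 = 1 := morphM_at0 (matched_morphl mp).
Let beta0 : beta 0 = 1 := morphM_at0 (matched_morphr mp).

Lemma matched_lambda_inl (a : G) (x : matched_prod mp) :
  lambda ((a, 0) : matched_prod mp) x = (lambda a x.1, beta a x.2).
Proof.
case: x => x y; rewrite matched_prod_lambdaE alpha0 invg1 !aut1 raddf0.
by rewrite lambda0 aut1.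
Qed.

Lemma matched_lambda_inr (b : H) (x : matched_prod mp) :
  lambda ((0, b) : matched_prod mp) x = (alpha b x.1, lambda b x.2).
Proof.
case: x => x y; rewrite matched_prod_lambdaE beta0 invg1 !aut1 raddf0.
by rewrite lambda0 aut1.
Qed.

Lemma brace_hom_inl : brace_hom (fun a : G => (a, 0) : matched_prod mp).
Proof.
split=> a a'; first by congr pair; rewrite addr0.
by rewrite [RHS]brace_mulE matched_lambda_inl brace_mulE raddf0;
   congr pair; rewrite addr0.
Qed.

Lemma brace_hom_inr : brace_hom (fun b : H => (0, b) : matched_prod mp).
Proof.
split=> b b'; first by congr pair; rewrite addr0.
by rewrite [RHS]brace_mulE matched_lambda_inr brace_mulE raddf0;
   congr pair; rewrite addr0.
Qed.

End Factors.

(** * Axes of an iterated matched product *)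

Section Axes.
Variables (n : nat) (B : 'I_n -> leftBraceType).

(** A total function of both indices, so that no proof of [i = k] has to occur
    in the definitions by recursion on the construction below. *)
Definition place (i k : 'I_n) (x : B i) : B k :=
  if i =P k is ReflectT e then ecast k (B k) e x else 0.

Lemma place_id i (x : B i) : place i x = x.
Proof. by rewrite /place; case: eqP => // e; rewrite (eq_axiomK e). Qed.

Lemma place_neq i k (x : B i) : i != k -> place k x = 0.
Proof. by rewrite /place; case: eqP. Qed.

Lemma place_hom i k : brace_hom (@place i k).
Proof.
case: (eqVneq i k) => [e|ne].
  by case: _ / e; split=> x y; rewrite !place_id.
by split=> x y; rewrite !place_neq // ?addr0 // -brace_one mulg1.
Qed.

Fixpoint axis_in (i : 'I_n) j P (D : iterated_mp B j P) : B i -> P :=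
  match D with
  | IMPfirst n_gt0 => fun x => place (Ordinal n_gt0) x
  | IMPnext _ _ D' lt_jn _ _ _ => fun x =>
      (@axis_in i _ _ D' x, place (Ordinal lt_jn) x)
  end.

(** For [i < j] this is the projection to the factor [B i]: all but one of the
    summands produced by the recursion are then zero. *)
Fixpoint axis_coord (i : 'I_n) j P (D : iterated_mp B j P) : P -> B i :=
  match D with
  | IMPfirst n_gt0 => fun y => @place (Ordinal n_gt0) i y
  | IMPnext _ _ D' lt_jn _ _ _ => fun y =>
      @axis_coord i _ _ D' y.1 + @place (Ordinal lt_jn) i y.2
  end.

#[global] Arguments axis_in i {j P} D x.
#[global] Arguments axis_coord i {j P} D y.

Lemma axis_in_ge (i : 'I_n) j P (D : iterated_mp B j P) x :
  (j <= i)%N -> axis_in i D x = 0.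
Proof.
elim: D => [n_gt0|{}j {}P D IH lt_jn alpha beta mp] /= le_ji.
  by apply: place_neq; apply: contraTneq le_ji => ->.
rewrite IH 1?ltnW // place_neq //.
by apply: contraTneq le_ji => ->; rewrite /= ltnn.
Qed.

Lemma axis_coord0 i j P (D : iterated_mp B j P) : axis_coord i D 0 = 0.
Proof.
have place0 k : @place k i 0 = 0 by apply: brace_hom0 (place_hom _ _).
by elim: D => [n_gt0|{}j {}P D IH lt_jn alpha beta mp] /=;
  rewrite ?IH place0 ?addr0.
Qed.

(** At each stage at most one of the two components of [axis_in i D x] is
    nonzero, so that the map passes through one of the two factors, which are
    subbraces of the matched product. *)
Lemma axis_in_hom i j P (D : iterated_mp B j P) : brace_hom (axis_in i D).
Proof.
elim: D => [n_gt0|{}j {}P D IH lt_jn alpha beta mp] /=; first exact: place_hom.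
case: (eqVneq i (Ordinal lt_jn)) => [->|ne].
  have eqf : (fun x => (axis_in (Ordinal lt_jn) D x, place (Ordinal lt_jn) x))
              = (fun x => (0, x)) :> (_ -> matched_prod mp).
    by apply/funext => x; rewrite axis_in_ge // place_id.
  by rewrite eqf; apply: brace_hom_inr.
have eqf : (fun x => (axis_in i D x, place (Ordinal lt_jn) x))
            = (fun a => (a, 0) : matched_prod mp) \o axis_in i D.
  by apply/funext => x; rewrite /= place_neq.
by rewrite eqf; apply: brace_hom_comp (brace_hom_inl mp) IH.
Qed.

Lemma axis_inK (i : 'I_n) j P (D : iterated_mp B j P) :
  (i < j)%N -> cancel (axis_in i D) (axis_coord i D).
Proof.
elim: D => [n_gt0|{}j {}P D IH lt_jn alpha beta mp] /= lt_ij x.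
  have -> : Ordinal n_gt0 = i by apply/val_inj/esym/eqP; rewrite -leqn0.
  by rewrite !place_id.
case: (eqVneq i (Ordinal lt_jn)) lt_ij x => [-> _ x|ne lt_ij x].
  by rewrite axis_in_ge // axis_coord0 add0r !place_id.
rewrite IH.
  by rewrite /= (place_neq x ne) (brace_hom0 (place_hom _ _)) addr0.
move: lt_ij; rewrite ltnS leq_eqVlt => /predU1P[e|//].
by case/eqP: ne; apply: val_inj.
Qed.

Lemma mem_axis_in i j P (D : iterated_mp B j P) x : axis i D (axis_in i D x).
Proof.
have mem_place k : (place k x == 0) || (k == i).
  have [->|] := eqVneq k i; rewrite ?orbT // eq_sym => ne.
  by rewrite place_neq ?eqxx.
by elim: D => [n_gt0|{}j {}P D IH lt_jn alpha beta mp] /=; rewrite ?IH /=.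
Qed.

Lemma axis_ge0 (i : 'I_n) j P (D : iterated_mp B j P) y :
  (j <= i)%N -> axis i D y -> y = 0.
Proof.
elim: D y => [n_gt0|{}j {}P D IH lt_jn alpha beta mp] /= y le_ji.
  by case/orP => /eqP // e; move: le_ji; rewrite -e.
case: y => y z /= /andP[/IH-> //]; last exact: ltnW.
by case/orP => [/eqP->//|/eqP e]; move: le_ji; rewrite -e /= ltnn.
Qed.

Lemma axis_coordK i j P (D : iterated_mp B j P) y :
  axis i D y -> axis_in i D (axis_coord i D y) = y.
Proof.
elim: D y => [n_gt0|{}j {}P D IH lt_jn alpha beta mp] /= y.
  case/orP => [/eqP->|/eqP <-]; last by rewrite !place_id.
  by rewrite !(brace_hom0 (place_hom _ _)).
case: y => y z /= /andP[ax_y].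
case: (eqVneq i (Ordinal lt_jn)) ax_y => [-> ax_y _|ne ax_y].
  rewrite (axis_ge0 _ ax_y) //= axis_coord0 add0r !place_id.
  by rewrite axis_in_ge.
rewrite orbF => /eqP->.
by rewrite (brace_hom0 (place_hom _ _)) addr0 IH // place_neq.
Qed.

Lemma axis0 i j P (D : iterated_mp B j P) : axis i D 0.
Proof. by rewrite -(brace_hom0 (axis_in_hom i D)) mem_axis_in. Qed.

Lemma axisB i j P (D : iterated_mp B j P) x y :
  axis i D x -> axis i D y -> axis i D (x - y).
Proof.
move=> /axis_coordK <- /axis_coordK <-; have iH := axis_in_hom i D.
by rewrite -(brace_homN iH) -(brace_homD iH) mem_axis_in.
Qed.

End Axes.

(** * From compatible actions to left ideals *)

Lemma aut_eq0_or (A : zmodType) (f : zmodAut A) (p : bool) z :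
  (z == 0) || p -> (f z == 0) || p.
Proof. by case/orP => [/eqP->|->]; rewrite ?raddf0 ?eqxx ?orbT. Qed.

Section ActionsToIdeals.
Variables (n : nat) (B : 'I_n -> leftBraceType).
Variable alpha : forall j i : 'I_n, {multiplicative B j -> zmodAut (B i)}.

Lemma axis_alpha_to i k (b : B k) j P (D : iterated_mp B j P) y :
  axis i D y -> axis i D (alpha_to alpha D b y).
Proof.
elim: D y => [n_gt0|{}j {}P D IH lt_jn al be mp] y /=; first exact: aut_eq0_or.
by case/andP => /IH-> /aut_eq0_or->.
Qed.

(** Being componentwise, [alpha_to] sends each axis of the earlier stage into
    itself; the new axis is a full component of the product. *)
Lemma axis_lambda i j P (D : iterated_mp B j P) :
  matched_via alpha D -> forall x y : P, axis i D y -> axis i D (lambda x y).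
Proof.
elim: D => [n_gt0 _ x y|{}j {}P D IH lt_jn al be mp]; first exact: aut_eq0_or.
case=> /IH{}IH [mp' eqM] [a b] [y z] /andP[ax_y z0].
(* Equal multiplications have equal lambda maps. *)
rewrite lambdaE eqM.
rewrite -[X in axis _ _ X]/(lambda ((a, b) : matched_prod mp') (y, z)).
rewrite matched_prod_lambdaE; apply/andP; split.
  exact: axis_alpha_to (IH _ _ ax_y).
exact/aut_eq0_or/aut_eq0_or.
Qed.

Lemma matched_via_left_ideals P (D : iterated_mp B n P) :
  matched_via alpha D -> of_left_ideals D.
Proof.
move=> via i; apply: left_idealP; first exact: axis0.
- by move=> x y; apply: axisB.
- by move=> y x; apply: axis_lambda.
Qed.

End ActionsToIdeals.

(** * From left ideals to compatible actions *)

Section IdealsToActions.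
Variables (n : nat) (B : 'I_n -> leftBraceType) (Q : leftBraceType).
Variables (iota : forall i, B i -> Q) (pi : forall i, Q -> B i).
Arguments iota : clear implicits.
Arguments pi : clear implicits.
Hypothesis iota_hom : forall i, brace_hom (iota i).
Hypothesis iotaK : forall i, cancel (iota i) (pi i).
Hypothesis iota_stable :
  forall i q x, iota i (pi i (lambda q (iota i x))) = lambda q (iota i x).

Let iota_inj i : injective (iota i) := can_inj (@iotaK i).

Definition action_fun i (q : Q) (x : B i) : B i := pi i (lambda q (iota i x)).

Lemma iota_action_fun i q x : iota i (action_fun q x) = lambda q (iota i x).
Proof. exact: iota_stable. Qed.

Fact action_funD i q : {morph @action_fun i q : x y / x + y}.
Proof.
move=> x y; apply: (@iota_inj i).
by rewrite !(iota_action_fun, brace_homD (iota_hom i)) aut_funD.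
Qed.

Fact action_funK i q : cancel (@action_fun i q) (action_fun q^-1).
Proof.
by move=> x; apply: (@iota_inj i); rewrite !iota_action_fun lambdaV autVK.
Qed.

Fact action_funVK i q : cancel (@action_fun i q^-1) (action_fun q).
Proof.
by move=> x; apply: (@iota_inj i); rewrite !iota_action_fun lambdaV autKV.
Qed.

(** The restriction to a left ideal of the lambda map of the whole brace. *)
Definition action i q : zmodAut (B i) :=
  ZmodAut (action_funD q) (@action_funK i q) (@action_funVK i q).

Lemma iota_action i q x : iota i (action i q x) = lambda q (iota i x).
Proof. exact: iota_action_fun. Qed.

Lemma iota_actionV i q x :
  iota i ((action i q)^-1 x) = (lambda q)^-1 (iota i x).
Proof.
by apply: (can_inj (autVK (lambda q))); rewrite autKV -iota_action autKV.
Qed.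

Lemma actionM i : {morph action i : q r / q * r}.
Proof.
move=> q r; apply: zmodAutP => x; apply: (@iota_inj i).
by rewrite autM !iota_action lambda_morph.
Qed.

Lemma action_iota i (a : B i) : action i (iota i a) = lambda a.
Proof.
apply: zmodAutP => x; apply: (@iota_inj i).
by rewrite iota_action (brace_hom_lambda (iota_hom i)).
Qed.

(** Stability of the axis of [B j] keeps the second factor of
    [q + iota j b] on that axis, so that it acts through an element of [B j]. *)
Lemma action_add i j q (b : B j) :
  action i q * action i (iota j ((action j q)^-1 b)) = action i (q + iota j b).
Proof. by rewrite iota_actionV -actionM -add_mulE. Qed.

Definition ideal_alpha_fun (j i : 'I_n) : B j -> zmodAut (B i) :=
  action i \o iota j.

Fact ideal_alpha_morph j i : {morph @ideal_alpha_fun j i : a b / a * b}.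
Proof.
by move=> a b; rewrite /ideal_alpha_fun /= (brace_homM (iota_hom j)) actionM.
Qed.

HB.instance Definition _ j i :=
  isMultiplicative.Build (B j) (zmodAut (B i)) (@ideal_alpha_fun j i)
    (@ideal_alpha_morph j i).

Definition ideal_alpha j i : {multiplicative B j -> zmodAut (B i)} :=
  @ideal_alpha_fun j i.

Lemma ideal_alphaE j i b : ideal_alpha j i b = action i (iota j b).
Proof. by []. Qed.

(** Both sides are the action of [iota k c + iota j b]. The indices are
    arbitrary; [k = i] gives the identity that involves [lambda]. *)
Lemma ideal_alpha_compat i j k (b : B j) (c : B k) :
  ideal_alpha k i c * ideal_alpha j i ((ideal_alpha k j c)^-1 b) =
  ideal_alpha j i b * ideal_alpha k i ((ideal_alpha j k b)^-1 c).
Proof. by rewrite !ideal_alphaE !action_add addrC. Qed.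

Lemma ideal_alpha_diag i (a : B i) : ideal_alpha i i a = lambda a.
Proof. exact: action_iota. Qed.

(** The way an intermediate stage of the construction sits in the final brace
    [Q], as a product of axes. *)
Record stage_embedding j P (D : iterated_mp B j P) (e : P -> Q) : Prop :=
  StageEmbedding {
    stage_hom : brace_hom e;
    stage_axis :
      forall (k : 'I_n) x, (k < j)%N -> e (axis_in k D x) = iota k x }.

Lemma stage_first (n_gt0 : (0 < n)%N) (e : B (Ordinal n_gt0) -> Q) x :
  stage_embedding (IMPfirst B n_gt0) e -> e x = iota (Ordinal n_gt0) x.
Proof. by move=> eS; rewrite -(stage_axis eS) //= place_id. Qed.

Section NextStage.
Variables (j : nat) (P : leftBraceType) (D : iterated_mp B j P).
Variables (lt_jn : (j < n)%N).
Variables (al : B (Ordinal lt_jn) -> zmodAut P).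
Variables (be : P -> zmodAut (B (Ordinal lt_jn))) (mp : matched_pair al be).
Variable e : matched_prod mp -> Q.
Hypothesis eS : stage_embedding (IMPnext D mp) e.

Lemma stage_prev : stage_embedding D (fun a => e (a, 0)).
Proof.
split=> [|k x lt_kj].
  exact: (brace_hom_comp (stage_hom eS) (brace_hom_inl mp)).
rewrite -(stage_axis eS) /= ?ltnS 1?ltnW // place_neq //.
by apply: contraTneq lt_kj => ->; rewrite ltnn.
Qed.

Lemma stage_new x : e (0, x) = iota (Ordinal lt_jn) x.
Proof. by rewrite -(stage_axis eS) /= ?ltnSn // axis_in_ge // place_id. Qed.

Lemma stage_split y : e y = e (y.1, 0) + iota (Ordinal lt_jn) y.2.
Proof.
rewrite -stage_new -(brace_homD (stage_hom eS)).
by case: y => u v; congr e; congr pair; rewrite /= ?addr0 ?add0r.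
Qed.

End NextStage.

(** By [action_add], each factor of the recursive formula for [alpha_from]
    adds one more coordinate of [a]. *)
Lemma alpha_from_action j P (D : iterated_mp B j P) (e : P -> Q) i (a : P) :
  stage_embedding D e -> alpha_from ideal_alpha D i a = action i (e a).
Proof.
elim: D e i a => [n_gt0|{}j {}P D IH lt_jn al be mp] e i a eS /=.
  by rewrite ideal_alphaE (stage_first _ eS).
rewrite !(IH _ _ _ (stage_prev eS)) ideal_alphaE action_add.
by rewrite -(stage_split eS).
Qed.

Lemma alpha_to_lambda j P (D : iterated_mp B j P) (e : P -> Q) i (b : B i) y :
  stage_embedding D e ->
  e (alpha_to ideal_alpha D b y) = lambda (iota i b) (e y).
Proof.
elim: D e y => [n_gt0|{}j {}P D IH lt_jn al be mp] e y eS.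
  by rewrite !(stage_first _ eS) -iota_action.
rewrite [LHS](stage_split eS) [in RHS](stage_split eS) aut_funD -iota_action.
congr (_ + _).
exact: (IH _ _ (stage_prev eS)).
Qed.

(** Comparing lambda maps after the injective [e] forces the two actions that
    define each stage. *)
Lemma matched_via_ideals j P (D : iterated_mp B j P) (e : P -> Q) :
  stage_embedding D e -> injective e -> matched_via ideal_alpha D.
Proof.
elim: D e => [//|{}j {}P D IH lt_jn al be mp] e eS e_inj.
have e'S := stage_prev eS; have eH := stage_hom eS.
have e'_inj : injective (fun a => e (a, 0)) by move=> a a' /e_inj[].
split; first exact: IH e'S e'_inj.
have alE : al = @alpha_to _ _ ideal_alpha _ _ D (Ordinal lt_jn).
  apply/funext => b; apply: zmodAutP => y; apply: e'_inj.
  rewrite (alpha_to_lambda b y e'S) -(stage_new eS) -(brace_hom_lambda eH).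
  by rewrite matched_lambda_inr raddf0.
have beE : be = @alpha_from _ _ ideal_alpha _ _ D (Ordinal lt_jn).
  apply/funext => a; apply: zmodAutP => x; apply: (@iota_inj (Ordinal lt_jn)).
  rewrite (alpha_from_action _ _ e'S) iota_action -!(stage_new eS).
  by rewrite -(brace_hom_lambda eH) matched_lambda_inl raddf0.
(* The multiplications agree because the two matched pairs now do. *)
by move: mp {IH e eS e_inj e'S eH e'_inj}; rewrite alE beE => mp; exists mp.
Qed.

End IdealsToActions.

Theorem theorem2p4 (n : nat) (n_ge2 : (2 <= n)%N) (B : 'I_n -> leftBraceType)
    (P : leftBraceType) (D : iterated_mp B n P) :
  of_left_ideals D <->
  exists alpha : forall j i : 'I_n, {multiplicative B j -> zmodAut (B i)},
    [/\ forall (i j : 'I_n) (a : B i) (b : B j), j != i ->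
          lambda a * alpha j i ((alpha i j a)^-1 b) =
          alpha j i b * lambda ((alpha j i b)^-1 a),
        forall (i j k : 'I_n) (b : B j) (c : B k),
          j != i -> k != i -> k != j ->
          alpha k i c * alpha j i ((alpha k j c)^-1 b) =
          alpha j i b * alpha k i ((alpha j k b)^-1 c)
      & matched_via alpha D].
Proof.
split=> [idealD|[alpha [_ _]]]; last exact: matched_via_left_ideals.
have inH i := axis_in_hom i D; have inK (i : 'I_n) := axis_inK D (ltn_ord i).
have stable i q x : axis_in i D (axis_coord i D (lambda q (axis_in i D x))) =
                    lambda q (axis_in i D x).
  by apply: axis_coordK; apply: (idealD i).2; apply: mem_axis_in.
exists (ideal_alpha inH inK stable); split.
- move=> i j a b _.
  (* The case [k = i] of the exchange identity. *)
  by rewrite -!(ideal_alpha_diag inH inK stable) ideal_alpha_compat.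
- by move=> i j k b c _ _ _; apply: ideal_alpha_compat.
- by apply: (matched_via_ideals inH inK stable (D := D) (e := id)).
Qed.
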